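(* Let $\alpha$ be a positive real quadratic irrational. Then for every $\beta>2$ the limit $$\lim_{N\to\infty}\frac{\log Z_N(\alpha;\beta)}{N}$$ exists (as a real number); i.e., $\alpha$ has a 1-free energy limit for $\beta>2$.
   Context: Let $A_0=\begin{pmatrix}1&0\\1&1\end{pmatrix}$ and $A_1=\begin{pmatrix}1&1\\0&1\end{pmatrix}$. For a real number $\alpha$, a real number $\beta$ and a positive integer $N$, the Diophantine partition function is $$Z_N(\alpha;\beta)=\sum_{(i_1,\ldots,i_N)\in\{0,1\}^N}\frac{1}{|\alpha q-p|^{\beta}},$$ where $\binom{p}{q}$ denotes the right (second) column of the product $A_{i_1}A_{i_2}\cdots A_{i_N}$. A quadratic irrational is an irrational real root of a degree-two polynomial with integer coefficients. *)

(* Defs.v *)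
From mathcomp Require Import all_boot all_order all_algebra.
From mathcomp Require Import all_classical all_reals all_analysis.

Set Implicit Arguments.
Unset Strict Implicit.
Unset Printing Implicit Defensive.

Import Order.TTheory GRing.Theory Num.Theory.
Import numFieldNormedType.Exports.

Local Open Scope classical_set_scope.
Local Open Scope ring_scope.

(* [fareyA false] has rows (1, 0), (1, 1); [fareyA true] has rows (1, 1),
   (0, 1). *)
Definition fareyA (b : bool) : 'M[int]_2 :=
  \matrix_(i, j) (if b then (i <= j)%N else (j <= i)%N)%:R.

Definition farey_prod (N : nat) (w : N.-tuple bool) : 'M[int]_2 :=
  \prod_(k < N) fareyA (tnth w k).

(* The right column (p, q)^T of the product. *)
Definition farey_num (N : nat) (w : N.-tuple bool) : int :=
  farey_prod w ord0 ord_max.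

Definition farey_den (N : nat) (w : N.-tuple bool) : int :=
  farey_prod w ord_max ord_max.

(* Total definition: for rational [alpha] a summand may be a division by zero. *)
Definition diophZ (R : realType) (alpha beta : R) (N : nat) : R :=
  \sum_(w : N.-tuple bool)
    1 / (`| alpha * (farey_den w)%:~R - (farey_num w)%:~R | `^ beta).

Definition quadratic_irrational (R : realType) (alpha : R) : Prop :=
  irrational alpha /\
  exists P : {poly int}, size P = 3 /\ root (map_poly intr P) alpha.

(* Main.v *)
(** With F_N(a, b) the sum of |b q - a p|^-beta over the words of length N,
    splitting off the first letter gives F_{N+1}(a, b) = F_N(a, b - a) +
    F_N(a - b, b): for a, b > 0 one term is a step of the subtractive Euclidean
    algorithm, and the other one has arguments of opposite signs, for which F_N
    grows at most linearly in N because beta >= 2. Starting from (1, alpha),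
    this bounds Z_N between b_N^-beta and (N + 1)^2 min(a_N, b_N)^-beta, where
    (a_N, b_N) is the N-th Euclidean pair. For a quadratic irrational alpha
    these pairs are eventually periodic up to scaling by a constant factor
    (Lagrange), so both bounds have the same exponential growth rate. *)
Require Import Defs.
From mathcomp Require Import all_boot all_order all_algebra.
From mathcomp Require Import all_classical all_reals all_analysis.
From mathcomp Require Import ring lra zify.

Set Implicit Arguments.
Unset Strict Implicit.
Unset Printing Implicit Defensive.

Import Order.TTheory GRing.Theory Num.Theory.
Import numFieldNormedType.Exports.

Local Open Scope classical_set_scope.
Local Open Scope ring_scope.

(** * Splitting words at their first letter *)

Lemma sum_tuple_consE (R : realType) (N : nat) (f : N.+1.-tuple bool -> R) :
  \sum_(w : N.+1.-tuple bool) f w =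
  \sum_(w : N.-tuple bool) f [tuple of true :: w] +
  \sum_(w : N.-tuple bool) f [tuple of false :: w].
Proof.
rewrite (reindex (fun x : bool * N.-tuple bool => [tuple of x.1 :: x.2])) /=;
  last first.
  exists (fun t => (thead t, [tuple of behead t])) => [[b w]|t] _ /=.
    by rewrite theadE; congr (_, _); apply/val_inj.
  by rewrite [RHS]tuple_eta.
rewrite -(pair_bigA _
  (fun (b : bool) (w : N.-tuple bool) => f [tuple of b :: w])) /=.
by rewrite big_bool.
Qed.

Lemma farey_prod_cons (N : nat) (b : bool) (w : N.-tuple bool) :
  farey_prod [tuple of b :: w] = fareyA b *m farey_prod w.
Proof.
rewrite /farey_prod big_ord_recl tnth0; congr (_ * _).
by apply: eq_bigr => k _; rewrite tnthS.
Qed.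

Lemma farey_num_cons (N : nat) (b : bool) (w : N.-tuple bool) :
  farey_num [tuple of b :: w] = farey_num w + (if b then farey_den w else 0).
Proof.
rewrite /farey_num /farey_den farey_prod_cons mxE !big_ord_recl big_ord0 !mxE.
have -> : lift ord0 ord0 = ord_max :> 'I_2 by apply/val_inj.
by case: b; rewrite /= ?mul1r ?mul0r addr0.
Qed.

Lemma farey_den_cons (N : nat) (b : bool) (w : N.-tuple bool) :
  farey_den [tuple of b :: w] = farey_den w + (if b then 0 else farey_num w).
Proof.
rewrite /farey_num /farey_den farey_prod_cons mxE !big_ord_recl big_ord0 !mxE.
have -> : lift ord0 ord0 = ord_max :> 'I_2 by apply/val_inj.
by case: b; rewrite /= ?mul1r ?mul0r ?addr0 ?add0r // addrC.
Qed.

(* The homogeneous form of [diophZ], which is the case [a = 1], [b = alpha]. *)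
Definition diophF (R : realType) (beta : R) (N : nat) (a b : R) : R :=
  \sum_(w : N.-tuple bool)
    1 / (`| b * (farey_den w)%:~R - a * (farey_num w)%:~R | `^ beta).

Lemma diophF0 (R : realType) (beta a b : R) :
  diophF beta 0 a b = 1 / `|b| `^ beta.
Proof.
rewrite /diophF (big_pred1 [tuple]); last first.
  by move=> w; exact/esym/eqP/tuple0.
by rewrite /farey_num /farey_den /farey_prod big_ord0 !mxE /= mulr1 mulr0 subr0.
Qed.

(** The first matrix is absorbed into the linear form: [b * q - a * (p + q) = (b - a) * q - a * p]
    and [b * (q + p) - a * p = b * q - (a - b) * p]. *)
Lemma diophFS (R : realType) (beta : R) (N : nat) (a b : R) :
  diophF beta N.+1 a b = diophF beta N a (b - a) + diophF beta N (a - b) b.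
Proof.
rewrite /diophF sum_tuple_consE; congr (_ + _); apply: eq_bigr => w _;
  rewrite farey_num_cons farey_den_cons ?addr0 intrD;
  congr (1 / (`|_| `^ beta)); ring.
Qed.

Lemma diophFN (R : realType) (beta : R) (N : nat) (a b : R) :
  diophF beta N (- a) (- b) = diophF beta N a b.
Proof.
apply: eq_bigr => w _; do 2 f_equal.
by rewrite !mulNr -opprD normrN.
Qed.

Lemma diophF_ge0 (R : realType) (beta : R) (N : nat) (a b : R) :
  0 <= diophF beta N a b.
Proof. by apply: sumr_ge0 => w _; rewrite divr_ge0 ?powR_ge0. Qed.

(* At [beta = 2] the sum over the two branches of [1 / (x y)] telescopes, and
   [m ^ (2 - beta)] absorbs the excess of [beta] over [2]. *)
Lemma diophF_opposite_signs_le (R : realType) (beta m : R) (N : nat) (x y : R) :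
  2 <= beta -> 0 < m -> m <= x -> m <= y ->
  diophF beta N (- x) y <=
  m ^+ 2 / m `^ beta * ((y ^+ 2)^-1 + N%:R / (x * y)).
Proof.
move=> beta_ge2 m_gt0; elim: N x y => [|N IH] x y mx my.
  have y_gt0 : 0 < y by lra.
  rewrite diophF0 gtr0_norm // mul0r addr0 div1r.
  have pE (z : R) : 0 < z -> z `^ beta = z ^+ 2 * z `^ (beta - 2).
    move=> z_gt0; rewrite -powR_mulrn ?ltW // -powRD; first by congr (_ `^ _); lra.
    by rewrite [z == 0]gt_eqF // implybT.
  rewrite (pE _ m_gt0) (pE _ y_gt0).
  have -> : m ^+ 2 / (m ^+ 2 * m `^ (beta - 2)) = (m `^ (beta - 2))^-1.
    by field; rewrite !gt_eqF ?powR_gt0.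
  rewrite [X in X <= _]invfM mulrC ler_wpM2r ?invr_ge0 ?sqr_ge0 //.
  rewrite lef_pV2 ?posrE ?powR_gt0 //.
  by rewrite ge0_ler_powR ?nnegrE //; lra.
have [x_gt0 y_gt0] : 0 < x /\ 0 < y by split; lra.
rewrite diophFS opprK.
have -> : - x - y = - (x + y) by ring.
have := lerD (IH x (y + x) mx ltac:(lra)) (IH (x + y) y ltac:(lra) my).
move/le_trans; apply; rewrite -mulrDr ler_wpM2l //.
  by rewrite divr_ge0 ?exprn_ge0 ?powR_ge0 ?ltW.
(* The second branch supplies [1 / y ^+ 2]; the square term of the first one is paid for by the
   increment [1 / (x * y)]. *)
have h1 : ((y + x) ^+ 2)^-1 <= (x * y)^-1.
  by rewrite lef_pV2 ?posrE ?mulr_gt0 ?exprn_gt0 ?addr_gt0 //; nra.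
have h2 : N%:R / (x * (y + x)) + N%:R / ((x + y) * y) = N%:R / (x * y).
  by field; rewrite !gt_eqF ?addr_gt0.
have -> : N.+1%:R / (x * y) = N%:R / (x * y) + (x * y)^-1.
  by rewrite -natr1 mulrDl mul1r.
lra.
Qed.

(** * The subtractive Euclidean algorithm *)

Definition euclid_step (R : realType) (p : R * R) : R * R :=
  if p.1 < p.2 then (p.1, p.2 - p.1) else (p.1 - p.2, p.2).

Definition pair_min (R : realType) (p : R * R) : R := Num.min p.1 p.2.

(** Irrationality of the ratio, in a form that a subtraction preserves by a unimodular change of [u]
    and [v]. It excludes ties, so both coordinates stay positive. *)
Definition int_independent (R : realType) (p : R * R) : Prop :=
  forall u v : int, u%:~R * p.1 + v%:~R * p.2 = 0 -> u = 0 /\ v = 0.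

Definition positive_independent (R : realType) (p : R * R) : Prop :=
  [/\ 0 < p.1, 0 < p.2 & int_independent p].

Lemma int_independent_neq (R : realType) (p : R * R) :
  int_independent p -> p.1 != p.2.
Proof.
move=> ip; apply/eqP => e.
by have [|//] := ip 1 (-1); rewrite e; ring.
Qed.

Lemma positive_independent_step (R : realType) (p : R * R) :
  positive_independent p -> positive_independent (euclid_step p).
Proof.
case: p => a b [/= a0 b0 ip]; have /= neq := int_independent_neq ip.
rewrite /euclid_step /=; case: ltP => h; split => //=; [lra| |  | ].
- move=> u v /= e; have [|euv v0] := ip (u - v) v.
    by rewrite /= -e intrB; ring.
  by split; lia.
- by rewrite subr_gt0 lt_neqAle eq_sym neq.
- move=> u v /= e; have [|u0 euv] := ip u (v - u).
    by rewrite /= -e intrB; ring.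
  by split; lia.
Qed.

Lemma positive_independent_iter (R : realType) (p : R * R) (n : nat) :
  positive_independent p ->
  positive_independent (iter n (@euclid_step R) p).
Proof. by move=> ip; elim: n => //= n; apply: positive_independent_step. Qed.

Lemma pair_min_gt0 (R : realType) (p : R * R) :
  positive_independent p -> 0 < pair_min p.
Proof. by case=> a0 b0 _; rewrite lt_min a0. Qed.

Lemma pair_min_step (R : realType) (p : R * R) :
  positive_independent p -> pair_min (euclid_step p) <= pair_min p.
Proof.
case: p => a b [/= a0 b0 _]; rewrite /pair_min /euclid_step /=.
by case: ltP => h /=; rewrite ge_min lexx ?orbT.
Qed.

Lemma pair_min_iter (R : realType) (p : R * R) (n : nat) :
  positive_independent p ->
  pair_min (iter n (@euclid_step R) p) <= pair_min p.
Proof.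
move=> ip; elim: n => //= n; apply: le_trans; apply: pair_min_step.
exact: positive_independent_iter.
Qed.

(** * Bounds on the sums along the Euclidean pairs *)

Lemma ler_inv_powR (R : realType) (beta x y : R) :
  0 <= beta -> 0 < x -> x <= y -> 1 / y `^ beta <= 1 / x `^ beta.
Proof.
move=> beta_ge0 x0 xy; rewrite !div1r lef_pV2 ?posrE ?powR_gt0 //; last lra.
by rewrite ge0_ler_powR ?nnegrE //; lra.
Qed.

(** The branch of [diophFS] other than the Euclidean one has, up to a global sign, arguments of
    opposite signs. Their absolute values are [|a - b|] and the larger of [a] and [b], both at least
    [pair_min s]. *)
Lemma diophF_step (R : realType) (beta : R) (N : nat) (p : R * R) :
  2 <= beta -> positive_independent p ->
  let s := euclid_step p in
  diophF beta N s.1 s.2 <= diophF beta N.+1 p.1 p.2 <=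
  diophF beta N s.1 s.2 + 1 / pair_min s `^ beta * N.+1%:R.
Proof.
move=> beta_ge2 ip; cbv zeta; set s := euclid_step p.
have s_gt0 : 0 < pair_min s by apply/pair_min_gt0/positive_independent_step.
have bound x y : pair_min s <= x -> pair_min s <= y ->
    diophF beta N (- x) y <= 1 / pair_min s `^ beta * N.+1%:R.
  move=> hx hy.
  apply: le_trans (diophF_opposite_signs_le _ beta_ge2 s_gt0 hx hy) _.
  set m := pair_min s in s_gt0 hx hy *.
  have m2 : 0 < m ^+ 2 by rewrite exprn_gt0.
  have -> : 1 / m `^ beta * N.+1%:R =
      m ^+ 2 / m `^ beta * ((m ^+ 2)^-1 + N%:R / m ^+ 2).
    by rewrite -natr1; field; rewrite !gt_eqF ?powR_gt0.
  rewrite ler_wpM2l ?(divr_ge0 (ltW m2)) ?powR_ge0 // lerD //.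
    by rewrite lef_pV2 ?posrE ?exprn_gt0 //; nra.
  by rewrite ler_wpM2l // lef_pV2 ?posrE ?mulr_gt0 //; nra.
rewrite {}/s in s_gt0 bound *; move: s_gt0 bound.
case: p ip => a b [/= a0 b0 ip].
rewrite /pair_min /euclid_step diophFS /=; case: (ltP a b) => /= h _ bound.
  rewrite lerDl diophF_ge0 lerD2l /=.
  have -> : a - b = - (b - a) by ring.
  by apply: bound; rewrite ge_min ?lexx ?orbT //; apply/orP; left; lra.
rewrite lerDr diophF_ge0 [X in _ <= X]addrC lerD2r /=.
have -> : diophF beta N a (b - a) = diophF beta N (- a) (a - b).
  by rewrite -diophFN opprB.
by apply: bound; rewrite ge_min ?lexx ?orbT //; apply/orP; left; lra.
Qed.

(** Below, only the Euclidean branch is kept. Above, [pair_min] never increases, so the last pair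
    dominates the error of every step; [N] errors, each at most linear in [N], give the square. *)
Lemma diophF_euclid_bounds (R : realType) (beta : R) (N : nat) (p : R * R) :
  2 <= beta -> positive_independent p ->
  let s := iter N (@euclid_step R) p in
  1 / s.2 `^ beta <= diophF beta N p.1 p.2 <=
  1 / pair_min s `^ beta * N.+1%:R ^+ 2.
Proof.
move=> beta_ge2; elim: N p => [|N IH] p ip /=.
  case: (ip) => a0 b0 _.
  rewrite diophF0 gtr0_norm // lexx expr1n mulr1 ler_inv_powR ?pair_min_gt0 //.
    by lra.
  by rewrite ge_min lexx orbT.
rewrite -iterS iterSr.
have ip' := positive_independent_step ip.
have /= /andP[lo up] := IH _ ip'.
have /= /andP[lo' up'] := diophF_step N beta_ge2 ip.
rewrite (le_trans lo lo') /=; apply: (le_trans up').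
have hm : 1 / pair_min (euclid_step p) `^ beta <=
    1 / pair_min (iter N (@euclid_step R) (euclid_step p)) `^ beta.
  apply: ler_inv_powR; rewrite ?pair_min_iter //; first lra.
  by apply/pair_min_gt0/positive_independent_iter.
move: up hm; set M := 1 / pair_min (iter _ _ _) `^ beta => up hm.
have M0 : 0 <= M by rewrite divr_ge0 ?powR_ge0.
have hN : 0 <= N.+1%:R :> R by [].
have := ler_wpM2r hN hm.
rewrite -[N.+2%:R]natr1; nra.
Qed.

(** * Integer quadratic forms along the algorithm *)

Definition form_zero (R : realType) (A B C : int) (p : R * R) : Prop :=
  A%:~R * p.2 ^+ 2 + B%:~R * (p.1 * p.2) + C%:~R * p.1 ^+ 2 = 0.

Lemma form_zero_step (R : realType) (A B C : int) (p : R * R) :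
  form_zero A B C p ->
  if p.1 < p.2 then form_zero A (B + 2 * A) (A + B + C) (euclid_step p)
  else form_zero (A + B + C) (B + 2 * C) C (euclid_step p).
Proof.
case: p => a b; rewrite /form_zero /euclid_step /= => e.
by case: ltP => _ /=; rewrite -[RHS]e !intrD intrM; ring.
Qed.

(** [A * C < 0] says that the two roots [b / a] of the form have opposite signs. A step moves both
    roots by the same map, which keeps the negative one negative. *)
Lemma form_zero_indefinite_step (R : realType) (A B C : int) (p : R * R) :
  positive_independent p -> form_zero A B C p -> A * C < 0 ->
  exists A' B' C' : int, [/\ form_zero A' B' C' (euclid_step p), A' * C' < 0 &
    B' ^+ 2 - 4 * A' * C' = B ^+ 2 - 4 * A * C].
Proof.
move=> ip e AC; have := form_zero_step e.
case: p ip e => a b [/= a0 b0 ip]; have /= neq := int_independent_neq ip.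
rewrite /form_zero /= => e.
have {}AC : A%:~R * C%:~R < 0 :> R by rewrite -intrM ltrz0.
(* As [A] and [C] have opposite signs, [A * b - C * a] has the sign of [A]; so the sign of the new
   coefficient is read off from [a - b]. *)
have e' : (A + B + C)%:~R * (a * b) = (a - b) * (A%:~R * b - C%:~R * a).
  by rewrite !intrD; move: e; lra.
case: ltP => h e2.
  exists A, (B + 2 * A), (A + B + C); split => //; last by ring.
  rewrite -(ltrz0 R) intrM -(pmulr_llt0 _ (mulr_gt0 a0 b0)) -mulrA e'.
  have A2 : 0 < A%:~R ^+ 2 :> R by rewrite exprn_even_gt0 //=; nra.
  have : 0 < A%:~R ^+ 2 * b - A%:~R * C%:~R * a by nra.
  nra.
exists (A + B + C), (B + 2 * C), C; split => //; last by ring.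
have {}h : b < a by rewrite lt_neqAle eq_sym neq.
rewrite -(ltrz0 R) intrM -(pmulr_llt0 _ (mulr_gt0 a0 b0)) mulrAC e'.
have C2 : 0 < C%:~R ^+ 2 :> R by rewrite exprn_even_gt0 //=; nra.
have : A%:~R * C%:~R * b - C%:~R ^+ 2 * a < 0 by nra.
nra.
Qed.

(** If an outer coefficient vanishes, a coordinate factors out; independence then kills the
    remaining linear factor, hence [B] and the discriminant. *)
Lemma form_zero_outer_neq0 (R : realType) (A B C : int) (p : R * R) :
  positive_independent p -> form_zero A B C p -> B ^+ 2 - 4 * A * C != 0 ->
  A * C != 0.
Proof.
case: p => a b [/= a0 b0 ip]; rewrite /form_zero /= => e; apply: contraNneq.
move/eqP; rewrite mulf_eq0 => /orP[] /eqP z; rewrite z ?mulr0 ?mul0r subr0 in e *.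
  have [|_ ->] := ip C B; last by rewrite expr0n.
  by apply: (mulfI (lt0r_neq0 a0)); rewrite /= mulr0 -[RHS]e; ring.
have [|-> _] := ip B A; last by rewrite expr0n.
by apply: (mulfI (lt0r_neq0 b0)); rewrite /= mulr0 -[RHS]e; ring.
Qed.

(** The outer terms have the same sign, so the middle term has to cancel both. *)
Lemma form_zero_definite_middle (R : realType) (A B C : int) (p : R * R) :
  0 < p.1 -> 0 < p.2 -> form_zero A B C p -> 0 < A * C -> A * B < 0 /\ C * B < 0.
Proof.
case: p => a b /= a0 b0; rewrite /form_zero /= => e AC.
have {}AC : 0 < A%:~R * C%:~R :> R by rewrite -intrM ltr0z.
have ab0 := mulr_gt0 a0 b0.
have A2 : 0 < A%:~R ^+ 2 :> R by rewrite exprn_even_gt0 //=; nra.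
have C2 : 0 < C%:~R ^+ 2 :> R by rewrite exprn_even_gt0 //=; nra.
have a2 : 0 < a ^+ 2 by rewrite exprn_gt0.
have b2 : 0 < b ^+ 2 by rewrite exprn_gt0.
split; rewrite -(ltrz0 R) intrM -(pmulr_llt0 _ ab0).
  have -> : A%:~R * B%:~R * (a * b) =
     - (A%:~R ^+ 2 * b ^+ 2 + A%:~R * C%:~R * a ^+ 2).
    by apply/subr0_eq; rewrite -[RHS](mulr0 A%:~R) -[in RHS]e; ring.
  by rewrite oppr_lt0 addr_gt0 // mulr_gt0.
have -> : C%:~R * B%:~R * (a * b) =
   - (A%:~R * C%:~R * b ^+ 2 + C%:~R ^+ 2 * a ^+ 2).
  by apply/subr0_eq; rewrite -[RHS](mulr0 C%:~R) -[in RHS]e; ring.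
by rewrite oppr_lt0 addr_gt0 // mulr_gt0.
Qed.

(* As long as the conjugate root stays positive, [B] has the sign opposite to
   [A] and [C], so that each step decreases [|B|]. *)
Lemma form_zero_reach_indefinite (R : realType) (A B C : int) (p : R * R) :
  positive_independent p -> form_zero A B C p -> B ^+ 2 - 4 * A * C != 0 ->
  exists (n : nat) (A' B' C' : int),
    [/\ form_zero A' B' C' (iter n (@euclid_step R) p), A' * C' < 0 &
    B' ^+ 2 - 4 * A' * C' = B ^+ 2 - 4 * A * C].
Proof.
have [k] := ubnP `|B|%N; elim: k A B C p => // k IH A B C p Bk ip e D0.
have := form_zero_outer_neq0 ip e D0; rewrite neq_lt => /orP[AC|AC].
  by exists 0%N, A, B, C.
have ip' := positive_independent_step ip; have [a'0 b'0 _] := ip'.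
have [a0 b0 _] := ip.
have [AB CB] := form_zero_definite_middle a0 b0 e AC.
have := form_zero_step e; case: ltP => h e'.
- set B1 := B + 2 * A in e'; set C1 := A + B + C in e'.
  have D1 : B1 ^+ 2 - 4 * A * C1 = B ^+ 2 - 4 * A * C by rewrite /B1 /C1; ring.
  have D1' : B1 ^+ 2 - 4 * A * C1 != 0 by rewrite D1.
  have := form_zero_outer_neq0 ip' e' D1'; rewrite neq_lt => /orP[AC1|AC1].
    by exists 1%N, A, B1, C1.
  have [AB1 _] := form_zero_definite_middle a'0 b'0 e' AC1.
  have [|n [A' [B' [C' [? ? DD]]]]] := IH _ _ _ _ _ ip' e' D1'.
    (* [B] and [B + 2 * A] both have the sign opposite to [A], so the absolute value drops. *)
    by rewrite /B1 in AB1 *; nia.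
  by exists n.+1, A', B', C'; rewrite iterSr DD D1.
- set B1 := B + 2 * C in e'; set A1 := A + B + C in e'.
  have D1 : B1 ^+ 2 - 4 * A1 * C = B ^+ 2 - 4 * A * C by rewrite /B1 /A1; ring.
  have D1' : B1 ^+ 2 - 4 * A1 * C != 0 by rewrite D1.
  have := form_zero_outer_neq0 ip' e' D1'; rewrite neq_lt => /orP[AC1|AC1].
    by exists 1%N, A1, B1, C.
  have [_ CB1] := form_zero_definite_middle a'0 b'0 e' AC1.
  have [|n [A' [B' [C' [? ? DD]]]]] := IH _ _ _ _ _ ip' e' D1'.
    by rewrite /B1 in CB1 *; nia.
  by exists n.+1, A', B', C'; rewrite iterSr DD D1.
Qed.

Lemma form_zero_indefinite_uniq (R : realType) (A B C : int) (p q : R * R) :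
  0 < p.1 -> 0 < p.2 -> 0 < q.1 -> 0 < q.2 ->
  form_zero A B C p -> form_zero A B C q -> A * C < 0 ->
  p.2 * q.1 = q.2 * p.1.
Proof.
case: p q => [a b] [c d] /= a0 b0 c0 d0; rewrite /form_zero /= => e e' AC.
have {}AC : A%:~R * C%:~R < 0 :> R by rewrite -intrM ltrz0.
(* Eliminating [B] between the two equations leaves this product, whose second factor has the sign
   of [A] and cannot vanish. *)
have : (b * c - d * a) * (A%:~R * (b * d) - C%:~R * (a * c)) = 0.
  transitivity (0 * (c * d) - 0 * (a * b) : R); last by rewrite !mul0r subr0.
  by rewrite -{1}e -e'; ring.
move/eqP; rewrite mulf_eq0 => /orP[|/eqP z]; first by rewrite subr_eq0 => /eqP.
have A2 : 0 < A%:~R ^+ 2 :> R by rewrite exprn_even_gt0 //=; nra.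
have bd := mulr_gt0 b0 d0; have ac := mulr_gt0 a0 c0.
have : 0 < A%:~R * (A%:~R * (b * d) - C%:~R * (a * c)) by nra.
by rewrite z mulr0 ltxx.
Qed.

Lemma bounded_triples_collide (K : nat) (x y z : nat -> int) :
  (forall n, [/\ (`|x n| <= K)%N, (`|y n| <= K)%N & (`|z n| <= K)%N]) ->
  exists i j : nat, [/\ (i < j)%N, x i = x j, y i = y j & z i = z j].
Proof.
move=> bd.
pose c (n : int) : 'I_(2 * K).+1 := inord `|n + K%:Z|.
have cK (m n : int) : (`|m| <= K)%N -> (`|n| <= K)%N -> c m = c n -> m = n.
  by move=> hm hn /(congr1 val) /=; rewrite !inordK; lia.
pose T := ('I_(2 * K).+1 * 'I_(2 * K).+1 * 'I_(2 * K).+1)%type.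
pose f (i : 'I_#|{: T}|.+1) : T := (c (x i), c (y i), c (z i)).
have /injectivePn[i [j ij [ex ey ez]]] : ~~ injectiveb f.
  by apply/injectiveP => /leq_card; rewrite card_ord ltnn.
have [xi yi zi] := bd i; have [xj yj zj] := bd j.
have {}ex := cK _ _ xi xj ex; have {}ey := cK _ _ yi yj ey.
have {}ez := cK _ _ zi zj ez.
move: ij; rewrite -val_eqE neq_ltn /= => /orP[] ij; last by exists j, i.
by exists i, j.
Qed.

Lemma euclid_step_scale (R : realType) (c : R) (p : R * R) :
  0 < c -> euclid_step (c * p.1, c * p.2) =
           (c * (euclid_step p).1, c * (euclid_step p).2).
Proof.
move=> c0; rewrite /euclid_step /= ltr_pM2l //.
by case: ltP => _ /=; rewrite mulrBr.
Qed.

(* Lagrange's theorem: only finitely many integer forms of a given discriminant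
   have outer coefficients of opposite signs, and such a form has a single root
   in the positive quadrant, up to scaling. *)
Lemma euclid_eventually_periodic (R : realType) (A B C : int) (p : R * R) :
  positive_independent p -> form_zero A B C p -> B ^+ 2 - 4 * A * C != 0 ->
  exists (n0 L : nat) (c : R), [/\ (0 < L)%N, 0 < c &
    forall n, (n0 <= n)%N ->
      iter (n + L) (@euclid_step R) p =
      (c * (iter n (@euclid_step R) p).1, c * (iter n (@euclid_step R) p).2)].
Proof.
move=> ip e D0; set D := B ^+ 2 - 4 * A * C in D0 *.
have [k0 [A0 [B0 [C0 [e0 AC0 DE]]]]] := form_zero_reach_indefinite ip e D0.
have forms n : exists t : int * int * int,
    [/\ form_zero t.1.1 t.1.2 t.2 (iter (k0 + n) (@euclid_step R) p),
        t.1.1 * t.2 < 0 & t.1.2 ^+ 2 - 4 * t.1.1 * t.2 = D].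
  elim: n => [|n [[[A1 B1] C1] /= [e1 AC1 D1]]].
    by exists (A0, B0, C0); rewrite addn0.
  have := form_zero_indefinite_step (positive_independent_iter (k0 + n) ip) e1 AC1.
  move=> [A2 [B2 [C2 [e2 AC2 D2]]]].
  by exists (A2, B2, C2); rewrite addnS /= D2.
have [t tP] := choice forms.
(* Here [D = B ^+ 2 + 4 * |A * C|] with [A] and [C] nonzero integers, which bounds all three
   coefficients. *)
have bd n : [/\ (`|(t n).1.1| <= `|D|)%N, (`|(t n).1.2| <= `|D|)%N &
    (`|(t n).2| <= `|D|)%N].
  have [_ ] := tP n; case: (t n) => [[x y] z] /= xz <-.
  have [x0|x0|x0] := ltgtP x 0; last by rewrite x0 mul0r in xz.
    have z0 : 0 < z by rewrite -(nmulr_rlt0 _ x0).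
    by split; rewrite expr2; nia.
  have z0 : z < 0 by rewrite -(pmulr_rlt0 _ x0).
  by split; rewrite expr2; nia.
have [i [j [ij ex ey ez]]] := bounded_triples_collide bd.
have [ei ACi _] := tP i; have [ej _ _] := tP j.
rewrite -ex -ey -ez in ej.
have [ai bi _] := positive_independent_iter (k0 + i) ip.
have [aj bj _] := positive_independent_iter (k0 + j) ip.
have pq := form_zero_indefinite_uniq ai bi aj bj ei ej ACi.
set pi := iter _ _ p in ai bi pq; set pj := iter _ _ p in aj bj pq.
(* Both pairs are zeros of the same form, hence proportional; the ratio propagates to later pairs
   because a step commutes with positive scaling. *)
exists (k0 + i)%N, (j - i)%N, (pj.1 / pi.1); split.
- by rewrite subn_gt0.
- by rewrite divr_gt0.
move=> n /subnKC <-; elim: (n - _)%N => [|m IH].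
  rewrite addn0 -addnA subnKC ?(ltnW ij) // -/pi -/pj divfK ?gt_eqF //.
  rewrite mulrAC [pj.1 * _]mulrC pq mulfK ?gt_eqF //.
  by case: pj {ej aj bj pq}.
by rewrite addnS addSn /= IH euclid_step_scale // divr_gt0.
Qed.

(** * Growth rates and limits *)

(** Without its linear trend the sequence is [L]-periodic from [n0] on, so all its values already
    occur below [n0 + L]. *)
Lemma quasi_periodic_bounded (R : realType) (u : nat -> R) (n0 L : nat) (d : R) :
  (0 < L)%N -> (forall n, (n0 <= n)%N -> u (n + L)%N = u n + d) ->
  exists K : R, forall n, `|u n - d / L%:R * n%:R| <= K.
Proof.
move=> L0 per; pose v n := u n - d / L%:R * n%:R.
have vper n : (n0 <= n)%N -> v (n + L)%N = v n.
  move=> h; rewrite /v per // natrD; field.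
  by rewrite pnatr_eq0 -lt0n.
exists (\sum_(i < n0 + L) `|v i|) => n; rewrite -/(v n).
have [m] := ubnP n; elim: m n => // m IH n nm.
have [h|h] := ltnP n (n0 + L).
  by rewrite (bigD1 (Ordinal h)) //= lerDl sumr_ge0.
have h' : (L <= n)%N by apply: leq_trans h; rewrite leq_addl.
rewrite -(subnK h') vper; last by rewrite leq_subRL // addnC.
by apply: IH; lia.
Qed.

(** Used to absorb the logarithm of the polynomial factor [(N + 1) ^ 2]. *)
Lemma ln_le_linear (R : realType) (e : R) : 0 < e ->
  exists K : R, forall y, 0 < y -> ln y <= e * y + K.
Proof.
move=> e0; exists (- ln e) => y y0.
have : ln (e * y) <= e * y.
  have := @le_ln1Dx R (e * y - 1); rewrite subrKC => /(_ _).
  have ey := mulr_gt0 e0 y0.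
  by move=> /(_ ltac:(lra)); lra.
by rewrite lnM ?posrE //; lra.
Qed.

Lemma cvg_div_nat (R : realType) (s : nat -> R) (l : R) :
  (forall e, 0 < e -> exists K : R, forall n, `|s n - l * n%:R| <= e * n%:R + K) ->
  s n / n%:R @[n --> \oo] --> l.
Proof.
move=> H; apply/cvgrPdist_le => /= e e0.
have [K HK] := H (e / 2) ltac:(lra).
near=> n.
have n0 : 0 < n%:R :> R by rewrite ltr0n; near: n; exact: nbhs_infty_gt.
have nK : K * 2 / e <= n%:R by near: n; exact: nbhs_infty_ger.
rewrite distrC.
have -> : s n / n%:R - l = (s n - l * n%:R) / n%:R.
  by field; rewrite gt_eqF.
rewrite normrM normfV (gtr0_norm n0) ler_pdivrMr //.
apply: le_trans (HK n) _.
by rewrite ler_pdivrMr // in nK; lra.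
Unshelve. all: by end_near. Qed.

(** * From the quadratic irrational to the limit *)

Lemma quadratic_irrational_form (R : realType) (alpha : R) :
  0 < alpha -> quadratic_irrational alpha ->
  positive_independent (1, alpha) /\
  exists A B C : int, form_zero A B C (1, alpha) /\ B ^+ 2 - 4 * A * C != 0.
Proof.
move=> alpha_gt0 [irr [P [sP rP]]].
have indep : int_independent (1, alpha).
  move=> u v /= e; suff v0 : v = 0.
    split=> //; move: e; rewrite v0 mul0r addr0 mulr1 => /eqP.
    by rewrite intr_eq0 => /eqP.
  apply/eqP/negP => /negP v0; apply: irr.
  exists (- u%:~R / v%:~R) => //.
  rewrite fmorph_div rmorphN /= !ratr_int.
  have v0R : v%:~R != 0 :> R by rewrite intr_eq0.
  by apply: (mulIf v0R); rewrite divfK //; move: e; lra.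
split; first by split => //=; lra.
exists P`_2, P`_1, P`_0.
have e : (P`_2)%:~R * alpha ^+ 2 + (P`_1)%:~R * alpha + (P`_0)%:~R = 0 :> R.
  move/rootP: rP => <-.
  rewrite (@horner_coef_wide _ 3); last first.
    by rewrite -[3%N]sP size_poly.
  by rewrite !big_ord_recr big_ord0 /= !coef_map /= expr0 expr1; ring.
split; first by rewrite /form_zero /= mul1r expr1n mulr1.
(* The discriminant is the square of the derivative of [P] at [alpha]; its vanishing would make
   [alpha] rational. *)
apply/eqP => D0; have : (2 * (P`_2)%:~R * alpha + (P`_1)%:~R) ^+ 2 = 0 :> R.
  transitivity ((P`_1 ^+ 2 - 4 * P`_2 * P`_0)%:~R : R); last by rewrite D0.
  rewrite intrB rmorphXn /= !intrM.
  transitivity ((P`_1)%:~R ^+ 2 + 4 * (P`_2)%:~R *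
    ((P`_2)%:~R * alpha ^+ 2 + (P`_1)%:~R * alpha) : R); first by ring.
  have -> : (P`_2)%:~R * alpha ^+ 2 + (P`_1)%:~R * alpha = - (P`_0)%:~R :> R by lra.
  by ring.
move/eqP; rewrite sqrf_eq0 => /eqP z.
have [|_ /eqP] := indep P`_1 (2 * P`_2); first by rewrite /= intrM -[RHS]z; ring.
rewrite mulf_eq0 /= => /eqP P2.
by have := lead_coef_eq0 P; rewrite lead_coefE sP P2 eqxx -size_poly_eq0 sP.
Qed.

Theorem theorem4p5 (R : realType) (alpha : R)
    (alpha_gt0 : 0 < alpha) (alpha_quad : quadratic_irrational alpha)
    (beta : R) (beta_gt2 : 2 < beta) :
  exists l : R, ln (diophZ alpha beta N) / N%:R @[N --> \oo] --> l.
Proof.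
have [ip [A [B [C [e D0]]]]] := quadratic_irrational_form alpha_gt0 alpha_quad.
have [n0 [L [c [L0 c0 per]]]] := euclid_eventually_periodic ip e D0.
pose s n := iter n (@euclid_step R) (1, alpha).
have s0 n : positive_independent (s n) by exact: positive_independent_iter.
(* A period multiplies the pair by [c], so both logarithms gain [ln c] every [L] steps and share the
   slope [ln c / L]. *)
have [K1 HK1] : exists K : R, forall n, `|ln (s n).2 - ln c / L%:R * n%:R| <= K.
  apply: (@quasi_periodic_bounded _ _ n0) => // n h.
  have [_ b0 _] := s0 n.
  by rewrite /s per //= lnM ?posrE // addrC.
have [K2 HK2] : exists K : R, forall n,
    `|ln (pair_min (s n)) - ln c / L%:R * n%:R| <= K.
  apply: (@quasi_periodic_bounded _ _ n0) => // n h.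
  rewrite /s per // {1}/pair_min /= -minr_pMr ?ltW // lnM ?posrE //;
    last exact/pair_min_gt0/s0.
  by rewrite addrC.
exists (- beta * (ln c / L%:R)); apply: cvg_div_nat => eps eps0.
have [K3 HK3] := @ln_le_linear R (eps / 2) ltac:(lra).
(* [K1] and [K2] come from the lower and upper bounds; [eps + 2 * |K3|] comes from
   [2 * ln (n + 1) <= eps * (n + 1) + 2 * K3]. *)
exists (beta * K1 + beta * K2 + eps + 2 * `|K3|) => n.
have -> : diophZ alpha beta n = diophF beta n 1 alpha.
  by apply: eq_bigr => w _; rewrite (mul1r (farey_num w)%:~R).
have /= /andP[lo up] := diophF_euclid_bounds n (ltW beta_gt2) ip.
have [_ b0 _] := s0 n; have m0 := pair_min_gt0 (s0 n).
have n1 : 0 < n.+1%:R :> R by [].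
have F0 : 0 < diophF beta n 1 alpha.
  by apply: lt_le_trans lo; rewrite divr_gt0 ?powR_gt0.
have {}lo : - (beta * ln (s n).2) <= ln (diophF beta n 1 alpha).
  rewrite -ln_powR -lnV ?posrE ?powR_gt0 // -div1r.
  by rewrite ler_ln ?posrE // divr_gt0 ?powR_gt0.
have {}up : ln (diophF beta n 1 alpha) <=
    - (beta * ln (pair_min (s n))) + ln n.+1%:R *+ 2.
  rewrite -ln_powR -lnV ?posrE ?powR_gt0 // -div1r -lnXn // -lnM ?posrE
    ?exprn_gt0 ?divr_gt0 ?powR_gt0 //.
  by rewrite ler_ln ?posrE ?(lt_le_trans F0 up).
have := HK3 _ n1; rewrite -[X in _ * X]natr1 => hn.
have /ler_normlP[] := HK1 n; have /ler_normlP[] := HK2 n.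
have := ler_norm K3.
set k := ln c / L%:R; set lb := ln (s n).2; set lm := ln (pair_min (s n)).
have bt : 0 <= beta by lra.
move=> hK3 h1 h2 h3 h4.
have K10 : 0 <= beta * K1 by apply: mulr_ge0 => //; lra.
have K20 : 0 <= beta * K2 by apply: mulr_ge0 => //; lra.
have := ler_wpM2l bt h1; have := ler_wpM2l bt h4.
move=> g4 g1; have K30 := normr_ge0 K3.
have e0 : 0 <= eps * n%:R by rewrite mulr_ge0 // ltW.
rewrite -/lb -/lm in lo up g1 g4 *.
rewrite ler_norml; apply/andP; split; lra.
Qed.
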